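(* Let $\alpha=\alpha_0^{p^s}\in\mathcal{T}_2\setminus\{0\}$, where $\alpha_0\in\mathcal{T}_2$ is such that $x^n-\alpha_0$ is irreducible over $\mathcal{R}_2$. Let $\beta\in\mathcal{T}_2\setminus\{0\}$, and let $\mathcal{C}=\langle(x^n-\alpha_0)^\nu\rangle$ be an $(\alpha+\gamma\beta)$-constacyclic code of length $np^s$ over $\mathcal{R}_2$, where $0\le\nu\le2p^s$. Then the Hamming distance $d_H(\mathcal{C})$ of the code $\mathcal{C}$ is given by $$d_H(\mathcal{C})=\begin{cases}1&\text{if }0\le\nu\le p^s;\\ \ell+2&\text{if }p^s+\ell p^{s-1}+1\le\nu\le p^s+(\ell+1)p^{s-1},\text{ where }0\le\ell\le p-2;\\ (i+1)p^k&\text{if }2p^s-p^{s-k}+(i-1)p^{s-k-1}+1\le\nu\le2p^s-p^{s-k}+ip^{s-k-1},\\&\quad\text{where }1\le i\le p-1\text{ and }1\le k\le s-1;\\0&\text{if }\nu=2p^s.\end{cases}$$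
   Context: $\mathcal{R}_2$ is a finite commutative chain ring with unity, with maximal ideal $\langle\gamma\rangle$, where $\gamma\neq0$ and $\gamma^2=0$; its residue field has order $p^m$, $p$ prime. $\zeta\in\mathcal{R}_2$ has multiplicative order $p^m-1$ and $\mathcal{T}_2=\{0,1,\zeta,\dots,\zeta^{p^m-2}\}$. $n,s$ are positive integers with $\gcd(n,p)=1$. For a unit $\lambda$, $\lambda$-constacyclic codes of length $N$ over $\mathcal{R}_2$ are identified with ideals of $\mathcal{R}_2[x]/\langle x^N-\lambda\rangle$, whose elements are represented by polynomials of degree less than $N$. The Hamming weight $w_H(c(x))$ is the number of nonzero coefficients of $c(x)$, and $d_H(\mathcal{C})=\min\{w_H(c):c\in\mathcal{C}\setminus\{0\}\}$, with the convention $d_H(\{0\})=0$. *)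

(* Defs.v *)
From HB Require Import structures.
From mathcomp Require Import all_boot all_order all_algebra.

Set Implicit Arguments.
Unset Strict Implicit.
Unset Printing Implicit Defensive.

Import GRing.Theory.
Local Open Scope ring_scope.

Definition principal_ideal (A : finComNzRingType) (a : A) : {set A} :=
  [set b * a | b : A].

(* [idealr_closed] describes proper ideals. The improper ideal is comparable
   with every ideal, so leaving it out does not affect the chain condition. *)
Definition chain_ring (A : finComNzRingType) : Prop :=
  forall I J : {set A},
    idealr_closed I -> idealr_closed J -> (I \subset J) || (J \subset I).

Definition maximal_ideal (A : finComNzRingType) (M : {set A}) : Prop :=
  idealr_closed M /\
  forall I : {set A}, idealr_closed I -> M \subset I -> I = M.

(* The order of A/I, counted as the number of cosets of I. *)
Definition quotient_order (A : finComNzRingType) (I : {set A}) : nat :=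
  #|[set [set x + a | a in I] | x : A]|.

Definition is_unit (A : comNzRingType) (u : A) : Prop :=
  exists v : A, u * v = 1.

(* The library's [irreducible_poly] presupposes an integral domain of
   coefficients, and {poly R} has units of positive degree when R has nonzero
   nilpotents; this is irreducibility in an arbitrary commutative ring, to be
   used at A := {poly R}. *)
Definition irreducible_elt (A : comNzRingType) (f : A) : Prop :=
  [/\ f <> 0, ~ is_unit f &
      forall g h : A, f = g * h -> is_unit g \/ is_unit h].

Definition teichmuller_set (A : finComNzRingType) (zeta : A) (q : nat) :
    {set A} :=
  0 |: [set zeta ^+ (i : 'I_q.-1) | i : 'I_q.-1].

(* {poly %/ h} is a finite type and a commutative ring in the library, but the
   two structures are not joined there. *)
HB.instance Definition _ (R : finComNzRingType) (h : {poly R}) :=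
  Finite.on {poly %/ h}.

(* For h monic of positive degree N, the elements of {poly %/ h} are the
   polynomials of degree less than N. *)
Definition hamming_weight (R : finComNzRingType) (h : {poly R})
    (c : {poly %/ h}) : nat :=
  count (predC1 0) (c : {poly R}).

Definition hamming_distance (R : finComNzRingType) (h : {poly R})
    (C : {set {poly %/ h}}) : nat :=
  if [pick c in C | c != 0] is Some c0
  then hamming_weight [arg min_(c < c0 | (c \in C) && (c != 0))
                         hamming_weight c]
  else 0%N.

(* Main.v *)
From HB Require Import structures.
Require Import Defs.
From mathcomp Require Import all_boot all_order all_algebra all_fingroup.
From mathcomp Require Import cyclic zify ring.

Set Implicit Arguments.
Unset Strict Implicit.
Unset Printing Implicit Defensive.

Import GRing.Theory.
Local Open Scope quotient_scope.
Local Open Scope ring_scope.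

(** Write f = X^n - alpha0, lambda = alpha + gamma beta, and let F be the
    residue field of R.  The binomial theorem applied to
    X^n = f + alpha0 gives X^(n p^s) = f^(p^s) + alpha + p f k, and p is a
    multiple u gamma of gamma; so, modulo X^(n p^s) - lambda,
    f^(p^s) = gamma (beta - u f k).  The second factor is a unit, because beta
    is one and f is nilpotent.  Hence the code contains the constant gamma, of
    weight 1, when nu <= p^s ([hamming_distance_low]), it is zero when
    nu = 2 p^s ([hamming_distance_top]), and for nu = p^s + t it is generated
    by gamma f^t.

    In the last case every codeword is literally a polynomial gamma P of degree
    less than n p^s with P a multiple of f^t: as gamma p = 0, reducing modulo
    X^(n p^s) - lambda subtracts from gamma P a multiple of gamma f^(p^s)
    ([scaled_codeword]).  The annihilator of gamma is the maximal ideal, so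
    the weight of gamma P is that of the reduction of P over F, and the problem
    is to find the least weight of a nonzero multiple, of degree less than
    n p^s, of (X^n - a)^t over a field of characteristic p.  Sorting the
    monomials by their exponent modulo n reduces this to n = 1.

    For n = 1 the answer is the minimum, over t <= t' < p^s, of the product
    of the numbers (digit + 1) over the base p digits of t'.  The power
    (X - a)^t' reaches it, since (X - a)^(p v + r) is (X - a^p)^v evaluated at
    X^p, times (X - a)^r ([weight_XsubC_exp]).  Conversely
    ([weight_multiple_XsubC_exp]), let p v + r, with r < p, be the exact
    multiplicity of a in c.  Each of the p polynomials collecting the monomials
    of c by exponent modulo p is a multiple of (X - a^p)^v, hence has, if
    nonzero, a weight bounded below by induction; and at least r + 1 of them
    are nonzero, because a nonzero polynomial of degree less than p with a root
    of multiplicity r outside 0 has more than r terms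
    ([weight_sparse_multiple]).

    The values in the theorem are this minimum, computed in
    [digit_prod_corner] and [digit_prod_ge]; the range with ell is the case
    k = 0, i = ell + 1 of the range with i and k. *)

(** * The number of nonzero coefficients of a polynomial *)

Definition weight (R : nzRingType) (c : {poly R}) : nat := count (predC1 0) c.

Lemma weightE (R : nzRingType) (c : {poly R}) (N : nat) :
  (size c <= N)%N -> weight c = (\sum_(i < N) (c`_i != 0)%R)%N.
Proof.
move=> hN; rewrite /weight -sum1_count (big_nth 0) big_mkord.
rewrite -(big_mkord xpredT (fun i => (c`_i != 0) : nat)) (big_cat_nat (leq0n _) hN) //=.
rewrite [X in (_ + X)%N]big_nat_cond [X in (_ + X)%N]big1 ?addn0; last first.
  by move=> i /andP[/andP[hi _] _]; rewrite nth_default ?eqxx.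
by rewrite big_mkord big_mkcond; apply: eq_bigr => i _ /=; case: eqP.
Qed.

Lemma weight_gt0 (R : nzRingType) (c : {poly R}) : c != 0 -> (0 < weight c)%N.
Proof.
move=> c0; rewrite /weight -has_count; apply/hasP; exists (lead_coef c).
  by rewrite mem_nth // prednK // lt0n size_poly_eq0.
by rewrite /= lead_coef_eq0.
Qed.

Lemma weight0 (R : nzRingType) : weight (0 : {poly R}) = 0%N.
Proof. by rewrite /weight polyseq0. Qed.

Lemma weightD (R : nzRingType) (c d : {poly R}) :
  (weight (c + d) <= weight c + weight d)%N.
Proof.
rewrite !(@weightE _ _ (maxn (size c) (size d))) ?leq_maxl ?leq_maxr //; last first.
  exact: size_polyD.
rewrite -big_split /=; apply: leq_sum => i _; rewrite coefD.
have [->|_] := eqVneq c`_i 0; last by case: (_ == 0).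
by rewrite add0r; case: (_ == 0).
Qed.

Lemma weight_sum (R : nzRingType) (I : Type) (r : seq I) (F : I -> {poly R}) :
  (weight (\sum_(i <- r) F i) <= \sum_(i <- r) weight (F i))%N.
Proof.
elim: r => [|i r IH]; first by rewrite !big_nil weight0.
by rewrite !big_cons (leq_trans (weightD _ _)) ?leq_add2l.
Qed.

Lemma weightZ (R : nzRingType) (a : R) (c : {poly R}) :
  (weight (a *: c) <= (a != 0%R) * weight c)%N.
Proof.
have [->|a0] := eqVneq a 0; first by rewrite scale0r weight0.
rewrite mul1n !(@weightE _ _ (size c)) ?size_scale_leq //.
apply: leq_sum => i _; rewrite coefZ.
by have [->|_] := eqVneq c`_i 0; rewrite ?mulr0 ?eqxx //; case: (_ == 0).
Qed.

Lemma weightXnM (R : nzRingType) k (c : {poly R}) :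
  weight ('X^k * c) = weight c.
Proof.
rewrite -commr_polyXn (@weightE _ _ (k + size c)); last first.
  by rewrite (leq_trans (size_polyMleq _ _)) // size_polyXn addnS addnC.
rewrite (@weightE _ c (size c)) // big_split_ord /= big1 ?add0n => [|i _].
  by apply: eq_bigr => i _; rewrite coefMXn ltnNge leq_addr /= addKn.
by rewrite coefMXn ltn_ord eqxx.
Qed.

Lemma weightM (R : nzRingType) (c d : {poly R}) :
  (weight (c * d) <= weight c * weight d)%N.
Proof.
rewrite -{1}(coefK c) poly_def mulr_suml (leq_trans (weight_sum _ _)) //.
rewrite (@weightE _ c (size c)) // big_distrl /=; apply: leq_sum => i _.
by rewrite -scalerAl (leq_trans (weightZ _ _)) // weightXnM.
Qed.

Lemma weight_comp_Xn (R : nzRingType) (c : {poly R}) N :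
  (weight (c \Po 'X^N) <= weight c)%N.
Proof.
rewrite comp_polyE (leq_trans (weight_sum _ _)) //.
rewrite (@weightE _ c (size c)) //; apply: leq_sum => i _.
rewrite (leq_trans (weightZ _ _)) // -exprM -['X^_]mulr1 weightXnM.
by rewrite /weight polyseq1 /= oner_eq0 addn0 muln1.
Qed.

(** * Collecting the monomials by exponent modulo N *)

Definition section_poly (R : nzRingType) (N j : nat) (c : {poly R}) : {poly R} :=
  \poly_(i < size c) c`_(i * N + j).

Lemma coef_section (R : nzRingType) N j (c : {poly R}) i :
  (0 < N)%N -> (section_poly N j c)`_i = c`_(i * N + j).
Proof.
move=> N0; rewrite coef_poly; case: ltnP => // hi.
by rewrite nth_default // (leq_trans hi) // (leq_trans (leq_pmulr _ N0)) ?leq_addr.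
Qed.

Lemma size_section (R : nzRingType) N j (c : {poly R}) M :
  (0 < N)%N -> (size c <= N * M)%N -> (size (section_poly N j c) <= M)%N.
Proof.
move=> N0 hc; apply/leq_sizeP => i hi; rewrite coef_section // nth_default //.
by rewrite (leq_trans hc) // mulnC (leq_trans (leq_mul hi (leqnn N))) ?leq_addr.
Qed.

Lemma sum_blocks (F : nat -> nat) N M :
  \sum_(i < M * N) F i = \sum_(i < M) \sum_(j < N) F (i * N + j)%N.
Proof.
elim: M => [|M IH]; first by rewrite mul0n !big_ord0.
by rewrite big_ord_recr /= -IH mulSnr big_split_ord.
Qed.

Lemma weight_sections (R : nzRingType) N (c : {poly R}) :
  (0 < N)%N -> weight c = (\sum_(j < N) weight (section_poly N j c))%N.
Proof.
move=> N0; rewrite (@weightE _ _ (size c * N)) ?leq_pmulr //.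
rewrite (sum_blocks (fun i => (c`_i != 0) : nat)) exchange_big /=.
apply: eq_bigr => j _; rewrite (@weightE _ _ (size c)) ?size_poly //.
by apply: eq_bigr => i _; rewrite coef_section.
Qed.

(** Polynomials in X^N only shift exponents by multiples of N, so they act on
    the sections separately: this is what passes divisibility by a polynomial
    in X^N on to the sections. *)
Lemma section_comp_XnM (R : comNzRingType) N j (g c : {poly R}) :
  (j < N)%N ->
  section_poly N j ((g \Po 'X^N) * c) = g * section_poly N j c.
Proof.
move=> jN; have N0 : (0 < N)%N by apply: leq_ltn_trans jN.
have secX d : section_poly N j ('X^N * d) = 'X * section_poly N j d.
  apply/polyP => i; rewrite coefXM !coef_section // coefXnM.
  case: i => [|i]; first by rewrite mul0n add0n jN.
  by rewrite mulSn -addnA ltnNge leq_addr /= addKn.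
elim/poly_ind: g c => [|g a IH] c.
  rewrite comp_poly0 !mul0r; apply/polyP => i.
  by rewrite coef_section // !coef0.
rewrite comp_poly_MXaddC mulrDl -mulrA mulrDl -mulrA -secX -IH.
apply/polyP => i.
by rewrite coefD !coef_section // coefD -!/(_%:P) !coefCM coef_section.
Qed.

Lemma sum_sections (R : nzRingType) N (c : {poly R}) :
  (0 < N)%N -> c = \sum_(j < N) 'X^j * (section_poly N j c \Po 'X^N).
Proof.
move=> N0; apply/polyP => k; rewrite coef_sum.
have kN : (k %% N < N)%N by rewrite ltn_mod.
rewrite (bigD1 (Ordinal kN)) //= big1 ?addr0 => [|j ne_j].
  rewrite coefXnM ltnNge leq_mod /= coef_comp_poly_Xn // coef_section //.
  rewrite {2}(divn_eq k N) addnK dvdn_mull // {2}(divn_eq k N) addnK mulnK //.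
  by rewrite -divn_eq.
rewrite coefXnM; case: ltnP => // le_jk; rewrite coef_comp_poly_Xn //.
case: dvdnP => // -[i def_i]; case/eqP: ne_j; apply: val_inj => /=.
by rewrite -(subnK le_jk) def_i modnMDl modn_small.
Qed.

(** Modulo X^N - b one may replace X^N by b, which leaves a polynomial of degree
    less than N whose coefficients are the values at b of the sections. *)
Lemma dvdp_sections_at (F : fieldType) N b (c : {poly F}) :
  (0 < N)%N ->
  'X^N - b%:P %| c - \poly_(j < N) (section_poly N j c).[b].
Proof.
move=> N0; rewrite {1}(sum_sections c N0) poly_def -sumrB.
apply: (big_ind (fun q => 'X^N - b%:P %| q)) => [|x y|j _]; first exact: dvdp0.
  exact: dvdp_add.
rewrite -mul_polyC mulrC -mulrBl dvdp_mulr //.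
set q := section_poly _ _ _; have /factor_theorem[q1 def_q1] : root (q - q.[b]%:P) b.
  by rewrite rootE hornerD hornerN hornerC subrr.
rewrite -(comp_polyC q.[b] 'X^N) -comp_polyB def_q1 comp_polyM comp_polyB.
by rewrite comp_polyX comp_polyC dvdp_mull.
Qed.

(** Let j0 be the degree of c.  The operator X d/dX - j0 multiplies the
    coefficient of X^i by i - j0, which for i < p vanishes in F only at i = j0:
    it removes exactly one term.  It also lowers the multiplicity of the root a
    by at most 1, so induction on r applies. *)
Lemma weight_sparse_multiple (F : fieldType) (p : nat) (a : F) (r : nat)
    (c : {poly F}) :
  p \in [pchar F] -> a != 0 -> c != 0 -> (size c <= p)%N ->
  ('X - a%:P) ^+ r %| c -> (r < weight c)%N.
Proof.
move=> charFp a0; elim: r c => [|r IH] c c0 sc; first by rewrite weight_gt0.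
case/dvdpP=> b def_c; pose j0 := (size c).-1.
have sc0 : (0 < size c)%N by rewrite lt0n size_poly_eq0.
have j0p : (j0 < p)%N by rewrite prednK.
pose t := 'X * c^`() - j0%:R *: c.
have coef_t i : t`_i = (i%:R - j0%:R) * c`_i.
  rewrite coefB coefZ coefXM coef_deriv mulrBl; congr (_ - _).
  by case: i => [|i]; rewrite ?mul0r //= mulr_natl.
have nat_inj i : (i < p)%N -> (i%:R - j0%:R == 0 :> F) = (i == j0).
  have nz u v : (u < v)%N -> (v < p)%N -> (v%:R - u%:R == 0 :> F) = false.
    move=> uv vp; rewrite -natrB ?(ltnW uv) // -(dvdn_pcharf charFp).
    by rewrite gtnNdvd ?subn_gt0 // (leq_ltn_trans (leq_subr _ _)).
  move=> ip; have [lt_ij|lt_ji|->] := ltngtP i j0; last by rewrite subrr eqxx.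
    by rewrite -opprB oppr_eq0 nz.
  by rewrite nz.
have wc : weight c = (weight t).+1.
  have st : (size t <= size c)%N.
    by apply/leq_sizeP => i hi; rewrite coef_t nth_default ?mulr0.
  rewrite (weightE st) (weightE (leqnn _)).
  have j0c : (j0 < size c)%N by rewrite /j0 prednK.
  rewrite (bigD1 (Ordinal j0c)) //= [in RHS](bigD1 (Ordinal j0c)) //=.
  rewrite coef_t subrr mul0r eqxx add0n.
  rewrite -/(lead_coef c) lead_coef_eq0 c0 add1n; congr _.+1.
  apply: eq_bigr => i ne_i; rewrite coef_t mulf_eq0 nat_inj ?(leq_trans _ sc) //.
  by rewrite -val_eqE /= in ne_i; rewrite (negPf ne_i).
rewrite wc ltnS; apply: IH.
(* Otherwise c would be a monomial, which has no root outside 0. *)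
- apply: contraNneq a0 => t0; have c_j0 : c = lead_coef c *: 'X^j0.
    apply/polyP => i; rewrite coefZ coefXn.
    have [->|ne_i] := eqVneq i j0; first by rewrite mulr1.
    rewrite mulr0; have [ip|pi] := ltnP i p; last first.
      by rewrite nth_default // (leq_trans sc).
    move/polyP/(_ i)/eqP: t0; rewrite coef_t coef0 mulf_eq0 nat_inj //.
    by rewrite (negPf ne_i) => /eqP.
  have : c.[a] == 0.
    by rewrite def_c exprS !hornerM hornerXsubC subrr mul0r mulr0.
  by rewrite c_j0 hornerZ hornerXn mulf_eq0 lead_coef_eq0 (negPf c0) expf_eq0 => /andP[].
- by apply/leq_sizeP => i hi; rewrite coef_t nth_default ?mulr0 // (leq_trans sc).
have dvd_c : ('X - a%:P) ^+ r %| c.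
  by rewrite def_c dvdp_mull // dvdp_exp2l.
rewrite dvdp_sub //; last by rewrite -mul_polyC dvdp_mull.
rewrite dvdp_mull // def_c derivM deriv_exp derivXsubC mul1r -mulr_natl.
by rewrite dvdp_add // ?dvdp_mull // dvdp_exp2l.
Qed.

(** * Least weight of a multiple of a power of X - a in characteristic p *)

(** By the theorem of Lucas this is, for p prime and t < p^s, the weight of
    (X - 1)^t in characteristic p. *)
Fixpoint digit_prod (p s t : nat) : nat :=
  if s is s'.+1 then (t %% p).+1 * digit_prod p s' (t %/ p) else 1.

Lemma XsubC_exp_pchar (F : fieldType) p (a : F) :
  p \in [pchar F] ->
  ('X - a%:P) ^+ p = ('X - (a ^+ p)%:P) \Po 'X^p.
Proof.
move=> charFp; have charP : p \in [pchar {poly F}] by rewrite pchar_poly.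
rewrite -(pFrobenius_autE charP) rmorphB /= !pFrobenius_autE -rmorphXn /=.
by rewrite comp_polyB comp_polyX comp_polyC.
Qed.

(** The Frobenius map turns p-th powers into polynomials in X^p; the identity
    peels the lowest base p digit off the exponent. *)
Lemma XsubC_exp_divn (F : fieldType) p (a : F) t :
  p \in [pchar F] ->
  ('X - a%:P) ^+ t =
  (('X - (a ^+ p)%:P) ^+ (t %/ p) \Po 'X^p) * ('X - a%:P) ^+ (t %% p).
Proof.
move=> charFp; rewrite {1}(divn_eq t p) exprD mulnC exprM XsubC_exp_pchar //.
by rewrite (rmorphXn (comp_poly 'X^p)).
Qed.

Lemma weight_XsubC_exp (F : fieldType) p (a : F) s t :
  p \in [pchar F] -> (t < p ^ s)%N ->
  (weight (('X - a%:P) ^+ t)%R <= digit_prod p s t)%N.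
Proof.
move=> charFp; have p0 := prime_gt0 (pcharf_prime charFp).
elim: s a t => [|s IH] a t.
  by rewrite expn0 ltnS leqn0 => /eqP->; rewrite /weight polyseq1 /= oner_eq0.
rewrite expnS => ht; rewrite (XsubC_exp_divn _ _ charFp) (leq_trans (weightM _ _)) //.
rewrite /= mulnC leq_mul //.
  by rewrite (leq_trans (count_size _ _)) // size_exp_XsubC.
rewrite (leq_trans (weight_comp_Xn _ _)) // IH //.
by rewrite ltn_divLR // mulnC.
Qed.

(** Induction on s along the lowest base p digit of the multiplicity T of the
    root a, as T may exceed t.  Write T = p v + r and
    c = (X^p - a^p)^v d with d = (X - a)^r b.  Modulo (X - a)^p the polynomial d
    is congruent to some e of degree less than p, in which (X - a)^r still
    divides e while (X - a)^p does not divide d, so that e is nonzero.  The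
    terms of e count sections of d, hence of c, that are nonzero. *)
Lemma weight_multiple_XsubC_exp (F : fieldType) p (a : F) s t (c : {poly F}) :
  p \in [pchar F] -> a != 0 -> c != 0 -> (size c <= p ^ s)%N ->
  ('X - a%:P) ^+ t %| c ->
  exists2 t', (t <= t' < p ^ s)%N & (digit_prod p s t' <= weight c)%N.
Proof.
move=> charFp; have p0 := prime_gt0 (pcharf_prime charFp).
elim: s a t c => [|s IH] a t c a0 c0 sc dvd_c.
  exists 0%N; rewrite /= ?weight_gt0 // andbT leqNgt; apply/negP => t0.
  have := dvdp_leq c0 dvd_c; rewrite size_exp_XsubC => /leq_trans/(_ sc).
  by rewrite expn0 ltnS leqNgt t0.
have [T [b nz_b def_c]] := multiplicity_XsubC c a.
rewrite c0 /= in nz_b.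
have le_tT : (t <= T)%N.
  rewrite leqNgt; apply/negP => lt_Tt; move: dvd_c.
  rewrite -(subnK lt_Tt) addnS -addSn exprD {1}def_c dvdp_mul2r; last first.
    by rewrite expf_neq0 // polyXsubC_eq0.
  by rewrite exprS => /(dvdp_trans (dvdp_mulIl _ _)); rewrite dvdp_XsubCl (negPf nz_b).
pose v := (T %/ p)%N; pose r := (T %% p)%N.
have ltrp : (r < p)%N by rewrite ltn_mod.
pose d := ('X - a%:P) ^+ r * b.
have sec_c j : (j < p)%N -> section_poly p j c =
    ('X - (a ^+ p)%:P) ^+ v * section_poly p j d.
  move=> jp; rewrite -section_comp_XnM // /d mulrA -XsubC_exp_divn //.
  by rewrite mulrC -def_c.
pose e := \poly_(j < p) (section_poly p j d).[a ^+ p].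
have dvd_de : ('X - a%:P) ^+ p %| d - e.
  rewrite XsubC_exp_pchar // comp_polyB comp_polyX comp_polyC.
  exact: dvdp_sections_at.
have we : (r < weight e)%N.
  apply: (weight_sparse_multiple charFp a0); rewrite ?size_poly //.
    apply: contraNneq nz_b => e0; move: dvd_de; rewrite e0 subr0 /d.
    rewrite -(subnK ltrp) addnS -addSn exprD [X in _ %| X]mulrC dvdp_mul2r.
      by rewrite exprS => /(dvdp_trans (dvdp_mulIl _ _)); rewrite dvdp_XsubCl.
    by rewrite expf_neq0 // polyXsubC_eq0.
  rewrite -(@dvdp_subr _ _ d) ?dvdp_mulr //.
  by rewrite (dvdp_trans _ dvd_de) // dvdp_exp2l // ltnW.
have {we} hr : (r < \sum_(j < p) (section_poly p j c != 0%R))%N.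
  apply: leq_trans we _; rewrite (weightE (size_poly _ _)) leq_sum // => j _.
  rewrite coef_poly ltn_ord sec_c // mulf_eq0 negb_or.
  rewrite expf_neq0 ?polyXsubC_eq0 //=.
  have [->|_] := eqVneq (section_poly p j d) 0; first by rewrite horner0 eqxx.
  by case: (_ == 0).
have [j1 nz_j1] : exists j : 'I_p, section_poly p j c != 0.
  apply/existsP; apply: contraTT hr; rewrite negb_exists => /forallP hz.
  by rewrite big1 // => j _; apply/eqP; rewrite eqb0.
(* The induction hypothesis gives an exponent for each nonzero section; the one
   for the lightest section bounds all of them at once. *)
case: (@arg_minnP _ j1 (fun j : 'I_p => section_poly p j c != 0)
  (fun j : 'I_p => weight (section_poly p j c)) nz_j1) => j0 nz_j0 min_j0.
have [v' /andP[le_vv' v's] wt] : exists2 v', (v <= v' < p ^ s)%N &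
    (digit_prod p s v' <= weight (section_poly p j0 c))%N.
  apply: (IH (a ^+ p)) => //; first by rewrite expf_neq0.
    by rewrite size_section // -expnS.
  by rewrite sec_c // dvdp_mulr.
exists (v' * p + r)%N.
  apply/andP; split.
    by rewrite (leq_trans le_tT) // {1}(divn_eq T p) leq_add2r leq_mul2r le_vv' orbT.
  rewrite expnSr (@leq_trans (v'.+1 * p)) //.
    by rewrite mulSnr ltn_add2l.
  by rewrite leq_mul2r v's orbT.
rewrite /= modnMDl modn_small // divnMDl // divn_small // addn0.
rewrite (weight_sections c p0) (@leq_trans (r.+1 * weight (section_poly p j0 c))) //.
  by rewrite leq_mul2l wt orbT.
apply: leq_trans (leq_mul hr (leqnn _)) _.
rewrite big_distrl /= leq_sum // => j _.
by have [//|nz_j] := eqVneq (section_poly p j c) 0; rewrite mul1n min_j0.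
Qed.

Lemma weight_multiple_XnsubC (F : fieldType) p (a : F) n s t (b : {poly F}) :
  p \in [pchar F] -> (0 < n)%N -> a != 0 ->
  ('X^n - a%:P) ^+ t * b != 0 ->
  (size (('X^n - a%:P) ^+ t * b)%R <= n * p ^ s)%N ->
  exists2 t', (t <= t' < p ^ s)%N &
    (digit_prod p s t' <= weight (('X^n - a%:P) ^+ t * b)%R)%N.
Proof.
move=> charFp n0 a0; set c := _ * b => nz_c size_c.
have sec_c j : (j < n)%N ->
    section_poly n j c = ('X - a%:P) ^+ t * section_poly n j b.
  move=> jn; rewrite -section_comp_XnM // (rmorphXn (comp_poly 'X^n)) /=.
  by rewrite comp_polyB comp_polyX comp_polyC.
have [j nz_j] : exists j : 'I_n, section_poly n j c != 0.
  apply/existsP; apply: contraNT nz_c; rewrite negb_exists => /forallP hz.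
  rewrite (sum_sections c n0) big1 // => j _.
  by move/(_ j): hz; rewrite negbK => /eqP->; rewrite comp_poly0 mulr0.
have [||t' ht' le_t'] :=
    @weight_multiple_XsubC_exp _ p a s t _ charFp a0 nz_j.
- exact: size_section.
- by rewrite sec_c // dvdp_mulr.
exists t' => //; apply: (leq_trans le_t').
by rewrite (weight_sections c n0) (bigD1 j) //= leq_addr.
Qed.

Lemma weight_XnsubC_exp (F : fieldType) p (a : F) n s t :
  p \in [pchar F] -> (t < p ^ s)%N ->
  (weight (('X^n - a%:P) ^+ t)%R <= digit_prod p s t)%N.
Proof.
move=> charFp ht; apply: leq_trans (weight_XsubC_exp a charFp ht).
apply: leq_trans (weight_comp_Xn _ n).
by rewrite (rmorphXn (comp_poly 'X^n)) /= comp_polyB comp_polyX comp_polyC.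
Qed.

(** * Digit products in the ranges of the theorem *)

Lemma digit_prod_gt0 p s t : (0 < digit_prod p s t)%N.
Proof. by elim: s t => //= s IH t; rewrite muln_gt0 IH. Qed.

Lemma digit_prodD p s1 s2 t :
  digit_prod p (s1 + s2) t =
  (digit_prod p s1 t * digit_prod p s2 (t %/ p ^ s1))%N.
Proof.
elim: s1 t => [|s1 IH] t; first by rewrite expn0 divn1 mul1n.
by rewrite addSn /= IH mulnA -divnMA -expnS.
Qed.

Lemma digit_prod_mul p s t : (0 < p)%N -> digit_prod p s (t * p ^ s) = 1%N.
Proof.
move=> p0; elim: s t => //= s IH t.
by rewrite expnSr mulnA modnMl mulnK // IH.
Qed.

Lemma digit_prod_gt1 p s t :
  (0 < p)%N -> ~~ (p ^ s %| t)%N -> (1 < digit_prod p s t)%N.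
Proof.
move=> p0; elim: s t => [|s IH] t; first by rewrite dvd1n.
rewrite expnS /= => ndiv; have [dvd_pt|ndvd_pt] := boolP (p %| t)%N.
  rewrite (leq_trans (IH (t %/ p)%N _)) ?leq_pmull //.
  by apply: contra ndiv => dvd_s; rewrite -(divnK dvd_pt) mulnC dvdn_mul.
rewrite (@leq_trans (t %% p).+1) ?leq_pmulr ?digit_prod_gt0 //.
by rewrite ltnS lt0n.
Qed.

Lemma digit_prod_max p k : (1 < p)%N -> digit_prod p k (p ^ k).-1 = (p ^ k)%N.
Proof.
move=> p1; have p0 := ltnW p1; elim: k => //= k IH.
have -> : (p ^ k.+1).-1 = ((p ^ k).-1 * p + p.-1)%N.
  by rewrite expnSr -[in LHS](prednK (_ : 0 < p ^ k)%N) ?expn_gt0 ?p0 //; lia.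
by rewrite modnMDl modn_small ?prednK // divnMDl // divn_small ?prednK // addn0 IH -expnS.
Qed.

(** The exponent has k leading digits p - 1, then the digit i, then M zeros. *)
Lemma digit_prod_corner p M k i :
  (1 < p)%N -> (i < p)%N ->
  digit_prod p (M + k.+1) (((p ^ k).-1 * p + i) * p ^ M) = (i.+1 * p ^ k)%N.
Proof.
move=> p1 ip; have p0 := ltnW p1.
rewrite digit_prodD digit_prod_mul // mul1n mulnK ?expn_gt0 ?p0 //=.
by rewrite modnMDl modn_small // divnMDl // divn_small // addn0 digit_prod_max.
Qed.

(** Below p^(M + k + 1), exponents exceeding the given bound have k leading digits p - 1
    and a next digit at least i - 1.  If that digit is i - 1, some lower digit
    is nonzero and contributes a factor 2, and 2 i >= i + 1. *)
Lemma digit_prod_ge p M k i t :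
  (1 < p)%N -> (0 < i < p)%N ->
  (((p ^ k).-1 * p + i.-1) * p ^ M < t)%N -> (t < p ^ (M + k.+1))%N ->
  (i.+1 * p ^ k <= digit_prod p (M + k.+1) t)%N.
Proof.
move=> p1 /andP[i0 ip] lt_t t_lt; have p0 := ltnW p1.
have pM0 : (0 < p ^ M)%N by rewrite expn_gt0 p0.
pose w := (t %/ p ^ M)%N.
have le_w : ((p ^ k).-1 * p + i.-1 <= w)%N by rewrite leq_divRL // ltnW.
have w_lt : (w < p ^ k * p)%N by rewrite ltn_divLR // -expnSr -expnD addnC.
have pk0 : (0 < p ^ k)%N by rewrite expn_gt0 p0.
have def_wp : (w %/ p = (p ^ k).-1)%N.
  apply/eqP; rewrite eqn_leq -ltnS prednK // ltn_divLR // w_lt leq_divRL //.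
  by rewrite (leq_trans _ le_w) ?leq_addr.
rewrite digit_prodD -/w /= def_wp digit_prod_max //.
have := divn_eq w p; rewrite def_wp => def_w.
rewrite mulnA leq_mul2r; apply/orP; right.
have [lt_i|ge_i] := ltnP i.-1 (w %% p).
  apply: leq_trans (leq_pmull _ (digit_prod_gt0 _ _ _)).
  by rewrite ltnS -(prednK i0).
have mod_i : (w %% p = i.-1)%N by apply/eqP; rewrite eqn_leq ge_i; lia.
have P2 : (1 < digit_prod p M t)%N.
  apply: digit_prod_gt1 => //; apply: contraTN lt_t => dvd_t.
  by rewrite -(divnK dvd_t) -/w def_w mod_i -leqNgt.
rewrite mod_i prednK // (leq_trans _ (leq_mul P2 (leqnn _))) //; lia.
Qed.

(** * The residue field of a finite ring at a maximal ideal *)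

Lemma principal_idealP (A : finComNzRingType) (a x : A) :
  reflect (exists b, x = b * a) (x \in principal_ideal a).
Proof.
by apply: (iffP imsetP) => [[b _ ->]|[b ->]]; exists b.
Qed.

Lemma maximal_ideal_inv (R : finComNzRingType) (M : {set R}) (x : R) :
  maximal_ideal M -> x \notin M -> exists y, x * y - 1 \in M.
Proof.
case=> -[M0 M1 Mcl] maxM xM.
have Mopp y : y \in M -> - y \in M.
  by move=> yM; rewrite -[- y]addr0 -mulN1r Mcl.
pose I := [set u.1 + x * u.2 | u in setX M [set: R]].
have inI u y : u \in M -> u + x * y \in I.
  by move=> uM; apply/imsetP; exists (u, y); rewrite ?inE //= uM.
have [/imsetP[[u y]]|I1] := boolP (1 \in I).
  rewrite !inE /= andbT => uM def1; exists y.
  by rewrite def1 opprD addrCA subrr addr0 Mopp.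
case/negP: xM; rewrite -(maxM I); last first.
- by apply/subsetP => u uM; rewrite -[u]addr0 -(mulr0 x) inI.
- split=> //; first by rewrite -[0]addr0 -{2}(mulr0 x) inI.
  move=> a _ _ /imsetP[[u1 y1] + ->] /imsetP[[u2 y2] + ->].
  rewrite !inE /= !andbT => uM1 uM2.
  have -> : a * (u1 + x * y1) + (u2 + x * y2) = (a * u1 + u2) + x * (a * y1 + y2) by ring.
  by rewrite inI // Mcl.
by rewrite -[x]add0r -[x]mulr1 inI.
Qed.

(** Inverses in the quotient are picked in the finite ring R, among the inverses
    modulo M of a representative. *)
Lemma residue_field (R : finComNzRingType) (M : {set R}) :
  maximal_ideal M ->
  exists (F : fieldType) (phi : {rmorphism R -> F}),
    forall x, (phi x == 0) = (x \in M).
Proof.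
move=> maxM; pose P := fun x => x \in M.
pose I : idealr R := HB.pack P (isIdealr.Build R P maxM.1).
pose Q : comNzRingType := {ideal_quot I}.
have pi0 x : (\pi_Q x == 0 :> Q) = (x \in M).
  by rewrite -(rmorph0 \pi_Q) -Quotient.idealrBE subr0.
pose inv (q : Q) : Q := \pi_Q (odflt 0 [pick y | generic_quotient.repr q * y - 1 \in M]).
have mulVq : forall q : Q, q != 0 -> inv q * q = 1.
  move=> q; rewrite -{1}[q]reprK pi0 => nM; rewrite /inv.
  case: pickP => [y /= hy|]; last first.
    by have [y hy] := maximal_ideal_inv maxM nM; move/(_ y); rewrite hy.
  apply/eqP; rewrite -subr_eq0 -[X in _ * X]reprK -rmorphM -(rmorph1 \pi_Q) -rmorphB.
  by rewrite pi0 mulrC.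
have inv0 : inv 0 = 0.
  rewrite /inv; case: pickP => [y /= hy|]; last by rewrite rmorph0.
  have [[M0 M1 Mcl] _] := maxM; case/negP: M1.
  have r0 : generic_quotient.repr (0 : Q) \in M by rewrite -pi0 reprK.
  have := Mcl (-1) _ _ hy (Mcl y _ _ r0 M0).
  by rewrite addr0 mulrC [y * _]mulrC mulrN1 opprB subrK.
pose F : fieldType := HB.pack Q (GRing.ComNzRing_isField.Build Q mulVq inv0).
by exists F, (\pi_Q : {rmorphism R -> Q}).
Qed.

(** Lagrange's theorem in the additive group R/M, for the class of 1. *)
Lemma quotient_order_natr (R : finComNzRingType) (M : {set R}) :
  idealr_closed M -> (quotient_order M)%:R \in M.
Proof.
case=> M0 _ Mcl; pose gT : finGroupType := R.
have gM : group_set (M : {set gT}).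
  apply/group_setP; split=> // x y xM yM.
  by have := Mcl 1 _ _ xM yM; rewrite mul1r.
pose G := Group gM.
have nG : [set: gT] \subset 'N(G)%g.
  by rewrite sub_abelian_norm ?FinRing.zmod_abelian ?subsetT.
have -> : quotient_order M = #|[set: gT] / G|%g.
  rewrite card_quotient // /indexg /rcosets /quotient_order.
  have eq_coset (x : R) : [set x + a | a in M] = rcoset G x.
    rewrite rcosetE; apply/setP => y.
    by apply/imsetP/rcosetP => -[a aM ->]; exists a => //; apply: addrC.
  congr #|pred_of_set _|; apply/setP => B.
  by apply/imsetP/imsetP => -[x _ ->]; exists x; rewrite ?inE ?eq_coset.
rewrite -[_ \in M]/((1%R : gT) ^+ #|[set: gT] / G| \in G)%g.
apply: coset_idr; first exact: (subsetP nG).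
rewrite morphX ?(subsetP nG) ?inE //; apply/eqP.
by rewrite -order_dvdn order_dvdG // mem_quotient ?inE.
Qed.

(** * Powers of sums and units *)

(** The extra factor a * b in the error term matters: with a = X^n - alpha0 it
    makes the error nilpotent and not merely a multiple of p. *)
Lemma exprDn_prime_power (A : comNzRingType) (a b : A) p s : prime p ->
  exists c, (a + b) ^+ (p ^ s) =
            a ^+ (p ^ s) + b ^+ (p ^ s) + p%:R * (a * b * c).
Proof.
move=> p_pr.
have step (x y : A) : exists c, (x + y) ^+ p = x ^+ p + y ^+ p + p%:R * (x * y * c).
  case: p p_pr => [|[|p]] // p_pr.
  suff [c def_c] : exists c, \sum_(i < p.+1)
      x ^+ (p.+2 - bump 0 i) * y ^+ bump 0 i *+ 'C(p.+2, bump 0 i) =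
      p.+2%:R * (x * y * c).
    exists c; rewrite exprDn big_ord_recl big_ord_recr /= -def_c.
    by rewrite subn0 subnn bin0 binn !mulr1n !expr0 mul1r mulr1 addrA addrAC.
  apply: (big_ind (fun q => exists c, q = p.+2%:R * (x * y * c))).
  - by exists 0; rewrite !mulr0.
  - by move=> _ _ [c1 ->] [c2 ->]; exists (c1 + c2); rewrite -!mulrDr.
  move=> i _; rewrite /bump /= add1n.
  have /dvdnP[k ->] := prime_dvd_bin p_pr (ltn_ord i : 0 < i.+1 < p.+2)%N.
  rewrite subSS subSn -1?ltnS // !exprS -mulr_natl natrM.
  by exists (k%:R * (x ^+ (p - i) * y ^+ i)); ring.
elim: s => [|s [c IH]]; first by exists 0; rewrite !mulr0 !addr0 !expr1.
have [m def_m] : exists m, (p ^ s)%N = m.+1.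
  by exists (p ^ s).-1; rewrite prednK // expn_gt0 prime_gt0.
rewrite expnSr !exprM IH.
have [c1 ->] := step (a ^+ (p ^ s) + b ^+ (p ^ s)) (p%:R * (a * b * c)).
have [c2 ->] := step (a ^+ (p ^ s)) (b ^+ (p ^ s)).
set z := p%:R * (a * b * c); have -> : z ^+ p = z * z ^+ p.-1.
  by rewrite -exprS prednK ?prime_gt0.
rewrite def_m !exprS.
exists (a ^+ m * b ^+ m * c2 + c * z ^+ p.-1
  + (a * a ^+ m + b * b ^+ m) * (p%:R * c) * c1).
by rewrite /z; move: (_ ^+ p.-1) (_ ^+ p) (_ ^+ p) => z1 u v; ring.
Qed.

(** After multiplication by the inverse of b this is 1 - w with w nilpotent,
    inverted by the geometric sum. *)
Lemma unit_sub_nilpotent (A : comNzRingType) (b x k : A) M :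
  is_unit b -> x ^+ M = 0 -> is_unit (b - x * k).
Proof.
case=> v bv xM; pose w := x * k * v.
have wM : w ^+ M = 0 by rewrite !exprMn xM !mul0r.
have := subrX1 w M; rewrite wM sub0r => def1.
exists (v * \sum_(i < M) w ^+ i).
by rewrite mulrA mulrBl bv -/w -opprB mulNr -def1 opprK.
Qed.

(** * Rings whose maximal ideal is generated by an element of square zero *)

(** An inverse of x modulo g can be corrected, since g is nilpotent. *)
Lemma principal_max_inv (R : finComNzRingType) (g x : R) :
  maximal_ideal (principal_ideal g) -> g ^+ 2 = 0 ->
  x \notin principal_ideal g -> is_unit x.
Proof.
move=> maxg g2 /(maximal_ideal_inv maxg)[y /principal_idealP[b def_xy]].
have : is_unit (1 - g * (- b)).
  by apply: unit_sub_nilpotent g2; exists 1; rewrite mulr1.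
rewrite mulrN opprK mulrC -def_xy addrC subrK => -[z xyz].
by exists (y * z); rewrite mulrA.
Qed.

Lemma ann_principal_max (R : finComNzRingType) (g x : R) :
  maximal_ideal (principal_ideal g) -> g != 0 -> g ^+ 2 = 0 ->
  (g * x == 0) = (x \in principal_ideal g).
Proof.
move=> maxg nz_g g2; apply/eqP/idP => [gx|/principal_idealP[b ->]]; last first.
  by rewrite mulrCA -expr2 g2 mulr0.
apply: contraNT nz_g => /(principal_max_inv maxg g2)[y xy].
by rewrite -[g]mulr1 -xy mulrA gx mul0r.
Qed.

Lemma teichmuller_unit (R : finComNzRingType) (zeta a : R) q :
  q.-1.-primitive_root zeta -> a \in teichmuller_set zeta q -> a != 0 ->
  is_unit a.
Proof.
move=> prim; rewrite !inE => /orP[->//|/imsetP[i _ ->]] _.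
exists (zeta ^+ (q.-1 - i)).
by rewrite -exprD subnKC ?(prim_expr_order prim) // ltnW.
Qed.

(** * The codes generated by the powers of X^n - alpha0 *)

Lemma hamming_distance_eq (R : finComNzRingType) (h : {poly R})
    (C : {set {poly %/ h}}) (d : nat) (c0 : {poly %/ h}) :
  c0 \in C -> c0 != 0 -> (hamming_weight c0 <= d)%N ->
  (forall c, c \in C -> c != 0 -> (d <= hamming_weight c)%N) ->
  hamming_distance C = d.
Proof.
move=> c0C nz_c0 le_d d_le; rewrite /hamming_distance.
case: pickP => [c1 /andP[c1C nz_c1]|/(_ c0)]; last by rewrite c0C nz_c0.
case: arg_minnP => [|c /andP[cC nz_c] min_c]; first by rewrite c1C nz_c1.
apply/eqP; rewrite eqn_leq d_le // andbT (leq_trans _ le_d) // min_c //.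
by rewrite c0C nz_c0.
Qed.

(** If phi kills exactly the annihilator of g, scaling by g and reducing by phi
    make the same coefficients vanish. *)
Lemma weight_scale_map (R : comNzRingType) (F : fieldType)
    (phi : {rmorphism R -> F}) (g : R) (P : {poly R}) :
  (forall x, (phi x == 0) = (g * x == 0)) ->
  weight (g *: P) = weight (map_poly phi P).
Proof.
move=> ker_phi; rewrite (weightE (size_scale_leq _ _)).
rewrite (weightE (size_poly _ _)); apply: eq_bigr => i _.
by rewrite coefZ coef_map ker_phi.
Qed.

Section Code.

Variables (R : finComNzRingType) (g alpha alpha0 beta u : R) (p n s : nat).
Let f : {poly R} := 'X^n - alpha0%:P.
Let h : {poly R} := 'X^(n * p ^ s) - (alpha + g * beta)%:P.
Hypotheses (p_pr : prime p) (n0 : (0 < n)%N) (g2 : g ^+ 2 = 0).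
Hypotheses (def_p : p%:R = u * g) (def_alpha : alpha = alpha0 ^+ (p ^ s)).

Let N0 : (0 < n * p ^ s)%N.
Proof. by rewrite muln_gt0 n0 expn_gt0 prime_gt0. Qed.

Lemma Xn_power_split :
  exists k, 'X^(n * p ^ s) = f ^+ (p ^ s) + alpha%:P + (u * g)%:P * (f * k).
Proof.
have [c def_c] := exprDn_prime_power f alpha0%:P s p_pr.
exists (alpha0%:P * c); rewrite exprM -{1}(subrK alpha0%:P 'X^n) def_c.
by rewrite def_alpha rmorphXn -polyC_natr def_p -/f; congr (_ + _); ring.
Qed.

Lemma mk_monic_modulus : mk_monic h = h.
Proof.
by rewrite /mk_monic size_XnsubC // ltnS N0 monicXnsubC.
Qed.

(** The modulus and f^(p^s) differ by multiples of g only, so the factor g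
    identifies them. *)
Lemma scaled_modulus : g *: h = g *: f ^+ (p ^ s).
Proof.
have [k def_k] := Xn_power_split; rewrite /h def_k polyCD -!mul_polyC.
rewrite !polyCM; have : g%:P * g%:P = 0 :> {poly R} by rewrite -polyCM -expr2 g2.
move: (f ^+ _) => F gg.
transitivity (g%:P * F + (g%:P * g%:P) * (u%:P * (f * k) - beta%:P)); first by ring.
by rewrite gg mul0r addr0.
Qed.

(** The reduced representative of a multiple of g f^t is, as a polynomial, still
    a multiple of g f^t, because the reduction only subtracts multiples of g h,
    that is, of g f^(p^s). *)
Lemma scaled_codeword t (b : {poly R}) : (t <= p ^ s)%N ->
  exists b', in_qpoly h (g *: (f ^+ t * b)) = g *: (f ^+ t * b') :> {poly R}.
Proof.
move=> le_t; have h_mon : h \is monic by rewrite monicXnsubC.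
pose q := Pdiv.Ring.rdivp (f ^+ t * b) h.
exists (b - q * f ^+ (p ^ s - t)).
rewrite in_qpolyZ /= mk_monic_modulus.
have /(congr1 (fun r => g *: r)) := Pdiv.RingMonic.rdivp_eq h_mon (f ^+ t * b).
rewrite -/q scalerDr (scalerAr g q h) scaled_modulus => /eqP.
rewrite addrC -subr_eq => /eqP <-.
rewrite -scalerAr -scalerBr; congr (_ *: _).
by rewrite mulrBr mulrCA -exprD subnKC.
Qed.

(** In the quotient h = 0 turns [Xn_power_split] into f^(p^s) = g (beta - u f k),
    whose square vanishes; so f is nilpotent and the factor of g is a unit. *)
Lemma gamma_assoc_power : is_unit beta ->
  exists2 E, in_qpoly h f ^+ (p ^ s) = in_qpoly h g%:P * E & is_unit E.
Proof.
case=> v bv; have [k def_k] := Xn_power_split.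
have bv' : is_unit (in_qpoly h beta%:P).
  by exists (in_qpoly h v%:P); rewrite -rmorphM /= -polyCM bv rmorph1.
pose E := in_qpoly h beta%:P - in_qpoly h f * in_qpoly h (u%:P * k).
have h0 : in_qpoly h h = 0.
  by apply: val_inj; rewrite /= mk_monic_modulus Pdiv.RingMonic.rmodpp ?monicXnsubC.
have defF : in_qpoly h f ^+ (p ^ s) = in_qpoly h g%:P * E.
  have -> : E = in_qpoly h (beta%:P - f * (u%:P * k)).
    by rewrite /E -in_qpolyM -(rmorphB (in_qpoly h)).
  rewrite -in_qpolyM -(rmorphXn (in_qpoly h)); apply/eqP.
  rewrite -subr_eq0 -(rmorphB (in_qpoly h)) -h0; apply/eqP; congr in_qpoly.
  rewrite /h def_k polyCD !polyCM; move: (f ^+ _) => F; ring.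
exists E => //; apply: (@unit_sub_nilpotent _ _ _ _ (p ^ s * 2)) => //.
by rewrite exprM defF exprMn -rmorphXn -rmorphXn g2 !rmorph0 mul0r.
Qed.

Lemma hamming_distance_low nu : is_unit beta -> g != 0 -> (nu <= p ^ s)%N ->
  hamming_distance (principal_ideal (in_qpoly h (f ^+ nu))) = 1%N.
Proof.
move=> ubeta nz_g le_nu; have [E defF [V EV]] := gamma_assoc_power ubeta.
have val_g : in_qpoly h g%:P = g%:P :> {poly R}.
  rewrite in_qpoly_small // mk_monic_modulus size_XnsubC //.
  by rewrite size_polyC nz_g ltnS.
apply: (hamming_distance_eq (c0 := in_qpoly h g%:P)).
- apply/principal_idealP; exists (V * in_qpoly h f ^+ (p ^ s - nu)).
  rewrite (rmorphXn (in_qpoly h)) -mulrA -exprD subnK // defF.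
  by rewrite mulrC -mulrA EV mulr1.
- by apply: contraNneq nz_g => g0; rewrite -polyC_eq0 -val_g g0.
- rewrite /hamming_weight val_g polyseqC nz_g /=.
  by rewrite addn0 leq_b1.
- by move=> c _ nz_c; rewrite (@weight_gt0 _ (c : {poly R})).
Qed.

Lemma hamming_distance_top : is_unit beta ->
  hamming_distance (principal_ideal (in_qpoly h (f ^+ (2 * p ^ s)))) = 0%N.
Proof.
move=> ubeta; have [E defF _] := gamma_assoc_power ubeta.
rewrite /hamming_distance; case: pickP => // c /andP[/principal_idealP[b ->]].
rewrite (rmorphXn (in_qpoly h)) mulnC exprM defF exprMn.
by rewrite -(rmorphXn (in_qpoly h)) -rmorphXn g2 !rmorph0 mul0r mulr0 eqxx.
Qed.

(** Lightest codewords come from g f^t1, where t1 minimizes the digit product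
    over the exponents from t to p^s - 1. *)
Lemma hamming_distance_high (F : fieldType) (phi : {rmorphism R -> F}) t t1 d :
  is_unit beta -> g != 0 -> p \in [pchar F] ->
  (forall x, (phi x == 0) = (g * x == 0)) -> phi alpha0 != 0 ->
  (t <= t1 < p ^ s)%N -> (digit_prod p s t1 <= d)%N ->
  (forall t', (t <= t' < p ^ s)%N -> (d <= digit_prod p s t')%N) ->
  hamming_distance (principal_ideal (in_qpoly h (f ^+ (p ^ s + t)))) = d.
Proof.
move=> ubeta nz_g charFp ker_phi nz_a0 /andP[le_t t1_lt] le_d d_le.
have [E defF [V EV]] := gamma_assoc_power ubeta.
have phi_f : map_poly phi f = 'X^n - (phi alpha0)%:P.
  by rewrite /f rmorphB /= map_polyXn map_polyC.
have f_mon : f \is monic by rewrite monicXnsubC.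
have size_ft1 : (size (g *: f ^+ t1)%R <= n * p ^ s)%N.
  rewrite (leq_trans (size_scale_leq _ _)) //.
  rewrite (leq_trans (size_poly_exp_leq _ _)) // size_XnsubC //=.
  by rewrite ltn_mul2l n0.
have val_ft1 : in_qpoly h (g *: f ^+ t1) = g *: f ^+ t1 :> {poly R}.
  by rewrite in_qpoly_small // mk_monic_modulus size_XnsubC.
apply: (hamming_distance_eq (c0 := in_qpoly h (g *: f ^+ t1))).
- apply/principal_idealP; exists (V * in_qpoly h f ^+ (t1 - t)).
  rewrite -mul_polyC in_qpolyM !(rmorphXn (in_qpoly h)) -mulrA -exprD.
  rewrite addnC -addnA subnKC // exprD defF -[LHS]mul1r -EV; ring.
- apply: contraNneq nz_g => gf0; move: val_ft1; rewrite gf0.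
  move/polyP/(_ (size (f ^+ t1)).-1); rewrite coef0 coefZ -/(lead_coef _).
  by rewrite (monicP (monic_exp t1 f_mon)) mulr1 => <-.
- rewrite /hamming_weight val_ft1 -/(weight _) (weight_scale_map _ ker_phi).
  by rewrite rmorphXn /= phi_f (leq_trans (weight_XnsubC_exp _ _ charFp t1_lt)).
- move=> c /principal_idealP[b def_c] nz_c.
  have [b' def_c'] : exists b', c = g *: (f ^+ t * b') :> {poly R}.
    have qK (q : {poly %/ h}) : in_qpoly h q = q.
      by apply: val_inj; rewrite /= Pdiv.Ring.rmodp_small // size_mk_monic.
    have le_tp : (t <= p ^ s)%N by rewrite (leq_trans le_t) // ltnW.
    have [b' def_b'] := scaled_codeword (b * E : {poly %/ h}) le_tp.
    exists b'; rewrite -def_b'; congr polyn; rewrite def_c -mul_polyC !in_qpolyM qK.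
    by rewrite !(rmorphXn (in_qpoly h)) exprD defF; ring.
  have wc : hamming_weight c = weight (map_poly phi (f ^+ t * b')).
    by rewrite /hamming_weight def_c' -/(weight _) (weight_scale_map _ ker_phi).
  have size_mod : size (mk_monic h) = (n * p ^ s).+1.
    by rewrite mk_monic_modulus size_XnsubC.
  rewrite wc; move: wc; rewrite rmorphM rmorphXn /= phi_f => wc.
  have [||t' /d_le le_d' le_t'] :=
    @weight_multiple_XnsubC _ p (phi alpha0) n s t (map_poly phi b') charFp n0 nz_a0.
  + apply: contraNneq nz_c => P0; move: wc; rewrite P0 weight0.
    by move/eqP; apply: contraLR => /(@weight_gt0 _ (c : {poly R})); rewrite lt0n.
  + rewrite -phi_f -rmorphXn -rmorphM; apply/leq_sizeP => i le_i.
    apply/eqP; rewrite coef_map /= ker_phi -coefZ -def_c' nth_default //.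
    rewrite (leq_trans _ le_i) // -ltnS -size_mod.
    exact: size_mk_monic.
  by rewrite (leq_trans le_d').
Qed.

End Code.

Theorem theorem3p2
  (R : finComNzRingType) (gamma zeta : R) (p m n s nu : nat)
  (alpha alpha0 beta : R)
  (C : {set {poly %/ 'X^(n * p ^ s) - (alpha + gamma * beta)%:P}}) :
  chain_ring R ->
  maximal_ideal (principal_ideal gamma) ->
  gamma != 0 ->
  gamma ^+ 2 = 0 ->
  prime p ->
  quotient_order (principal_ideal gamma) = (p ^ m)%N ->
  (p ^ m).-1.-primitive_root zeta ->
  (0 < n)%N ->
  (0 < s)%N ->
  gcdn n p = 1%N ->
  alpha \in teichmuller_set zeta (p ^ m) ->
  alpha != 0 ->
  alpha0 \in teichmuller_set zeta (p ^ m) ->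
  alpha = alpha0 ^+ (p ^ s) ->
  irreducible_elt ('X^n - alpha0%:P) ->
  beta \in teichmuller_set zeta (p ^ m) ->
  beta != 0 ->
  (nu <= 2 * p ^ s)%N ->
  C = principal_ideal (in_qpoly _ (('X^n - alpha0%:P) ^+ nu)) ->
  [/\ (nu <= p ^ s)%N -> hamming_distance C = 1%N,
      forall l : nat, (l <= p - 2)%N ->
        (p ^ s + l * p ^ (s - 1) + 1 <= nu <=
         p ^ s + (l + 1) * p ^ (s - 1))%N ->
        hamming_distance C = (l + 2)%N,
      forall i k : nat, (1 <= i <= p - 1)%N -> (1 <= k <= s - 1)%N ->
        (2 * p ^ s - p ^ (s - k) + (i - 1) * p ^ (s - k - 1) + 1 <= nu <=
         2 * p ^ s - p ^ (s - k) + i * p ^ (s - k - 1))%N ->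
        hamming_distance C = ((i + 1) * p ^ k)%N
    & nu = (2 * p ^ s)%N -> hamming_distance C = 0%N].
Proof.
move=> _ max_g nz_g g2 p_pr card_res prim_zeta n0 s0 _ Ta nz_alpha Ta0
  def_alpha _ Tb nz_beta _ def_C.
have p1 := prime_gt1 p_pr; have p0 := ltnW p1.
have ubeta := teichmuller_unit prim_zeta Tb nz_beta.
have [F [phi ker_phi]] := residue_field max_g.
have pF : p%:R = 0 :> F.
  have : phi (p ^ m)%:R == 0.
    by rewrite ker_phi -card_res quotient_order_natr //; case: max_g.
  by rewrite natrX rmorphXn rmorph_nat expf_eq0 => /andP[_ /eqP].
have charFp : p \in [pchar F] by rewrite inE p_pr pF eqxx.
have [u def_p] : exists u, p%:R = u * gamma.
  by apply/principal_idealP; rewrite -ker_phi rmorph_nat pF.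
have ker_phi' x : (phi x == 0) = (gamma * x == 0).
  by rewrite ker_phi ann_principal_max.
have nz_phi : phi alpha0 != 0.
  have nz_a0 : alpha0 != 0.
    apply: contraNneq nz_alpha => a0; rewrite def_alpha a0 expr0n.
    by rewrite expn_eq0 eqn0Ngt p0.
  have [v av] := teichmuller_unit prim_zeta Ta0 nz_a0.
  have : phi alpha0 * phi v != 0 by rewrite -rmorphM av rmorph1 oner_eq0.
  by apply: contraNneq => ->; rewrite mul0r.
(* Both nontrivial ranges at once, with s = M + k + 1: here
   p^s + (p^k - 1) p^(M + 1) = 2 p^s - p^(s - k). *)
have key M k i : s = (M + k.+1)%N -> (0 < i < p)%N ->
    (p ^ s + ((p ^ k).-1 * p + i.-1) * p ^ M < nu <=
     p ^ s + ((p ^ k).-1 * p + i) * p ^ M)%N ->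
    hamming_distance C = (i.+1 * p ^ k)%N.
  move=> def_s i_bd /andP[lo hi]; rewrite def_C.
  have le_nu : (p ^ s <= nu)%N by rewrite (leq_trans _ (ltnW lo)) ?leq_addr.
  rewrite -(subnKC le_nu) in lo hi *; rewrite ltn_add2l in lo; rewrite leq_add2l in hi.
  have [_ ip] := andP i_bd.
  apply: (hamming_distance_high p_pr n0 g2 def_p def_alpha ubeta nz_g charFp
    ker_phi' nz_phi (t1 := ((p ^ k).-1 * p + i) * p ^ M)).
  - rewrite hi /= def_s expnD mulnC ltn_pmul2l ?expn_gt0 ?p0 // expnSr.
    have : (0 < p ^ k)%N by rewrite expn_gt0 p0.
    by move: (p ^ k)%N => P P0; nia.
  - by rewrite def_s digit_prod_corner.
  - move=> t' /andP[le_t' lt_t']; rewrite def_s in lt_t' *.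
    by rewrite digit_prod_ge // (leq_trans lo).
have top k : (k < s)%N -> exists2 M, s = (M + k.+1)%N & (p ^ s = p ^ k * (p * p ^ M))%N.
  move=> ks; exists (s - k.+1)%N; first by rewrite subnK.
  by rewrite -expnS -expnD; congr (_ ^ _)%N; lia.
split.
- by rewrite def_C; exact: (hamming_distance_low p_pr n0 g2 def_p def_alpha).
- move=> l le_l; have [M def_s def_ps] := top 0%N s0.
  have -> : (s - 1)%N = M by lia.
  move=> bounds; have -> : (l + 2 = l.+2 * p ^ 0)%N by lia.
  apply: (key M) => //; first by lia.
  by move: bounds; rewrite /=; lia.
- move=> i k i_bd k_bd; have [|M def_s def_ps] := top k; first by lia.
  have -> : (s - k - 1)%N = M by lia.
  have -> : (s - k)%N = M.+1 by lia.
  move=> bounds; rewrite addn1; apply: (key M) => //; first by lia.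
  have pk0 : (0 < p ^ k)%N by rewrite expn_gt0 p0.
  have pk : (p ^ s = (p ^ k).-1 * p * p ^ M + p * p ^ M)%N.
    by rewrite def_ps -{1}(prednK pk0) mulSnr mulnA.
  case: i i_bd bounds => [|i] // _; rewrite subn1 /= !mulnDl expnS {}pk.
  by move: (_ * p * _)%N (p * _)%N => A B; lia.
- move=> def_nu; rewrite def_C def_nu.
  exact: (hamming_distance_top p_pr n0 g2 def_p def_alpha).
Qed.
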